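(* Let $N\ge 1$, let $H^\alpha:\mathbb{R}\to\mathbb{R}$, $\alpha=1,\dots,N$, be continuous and coercive ($H^\alpha(s)\to+\infty$ as $|s|\to+\infty$). Let $F_0:\mathbb{R}^N\to\mathbb{R}$ be continuous, nonincreasing in each of its arguments, and semi-coercive: $F_0(p)\to+\infty$ as $\min_{\alpha}p^\alpha\to-\infty$. Then $$(F_0\overline G)\underline G=F_0G=(F_0\underline G)\overline G .$$
   Context: Godunov flux: for $a,b\in\mathbb{R}$, $G^\alpha(a,b)=\min_{[a,b]}H^\alpha$ if $a\le b$ and $G^\alpha(a,b)=\max_{[b,a]}H^\alpha$ if $a\ge b$. The Godunov semi-fluxes are the set-valued maps (values are subsets of $[-\infty,+\infty]$) $$\underline G^\alpha(q^\alpha,p^\alpha)=\begin{cases}\{-\infty\}&q^\alpha<p^\alpha\\ [-\infty,H^\alpha(p^\alpha)]&q^\alpha=p^\alpha\\ \{\max_{[p^\alpha,q^\alpha]}H^\alpha\}&q^\alpha>p^\alpha\end{cases}\qquad \overline G^\alpha(q^\alpha,p^\alpha)=\begin{cases}\{\min_{[q^\alpha,p^\alpha]}H^\alpha\}&q^\alpha<p^\alpha\\ [H^\alpha(p^\alpha),+\infty]&q^\alpha=p^\alpha\\ \{+\infty\}&q^\alpha>p^\alpha.\end{cases}$$ For a continuous semi-coercive function $F:\mathbb{R}^N\to\mathbb{R}$, nonincreasing in each argument, and $p\in\mathbb{R}^N$: $(FG)(p)$ is the value $F(q)$ for any $q\in\mathbb{R}^N$ with $F(q)=G^\alpha(q^\alpha,p^\alpha)$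 for all $\alpha$; $(F\underline G)(p)$ is the value $F(q)$ for any $q$ with $F(q)\in\underline G^\alpha(q^\alpha,p^\alpha)$ for all $\alpha$; $(F\overline G)(p)$ is the value $F(q)$ for any $q$ with $F(q)\in\overline G^\alpha(q^\alpha,p^\alpha)$ for all $\alpha$. In each case such $q$ exists and the value is independent of the choice of $q$; moreover $F\underline G$ and $F\overline G$ are again continuous, nonincreasing in each argument and semi-coercive, so the compositions in the statement make sense. *)

(* Defs.v *)
From HB Require Import structures.
From mathcomp Require Import all_boot all_order all_algebra.
From mathcomp Require Import all_classical all_reals all_analysis.

Set Implicit Arguments.
Unset Strict Implicit.
Unset Printing Implicit Defensive.

Import Order.TTheory GRing.Theory Num.Theory.
Import numFieldNormedType.Exports.

Local Open Scope classical_set_scope.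
Local Open Scope ring_scope.

(* H s --> +oo as |s| --> +oo *)
Definition coercive (R : realType) (H : R -> R) : Prop :=
  forall A : R, exists B : R, forall s : R, B < `|s| -> A < H s.

(* The minimum is taken in \bar R only because an iterated min needs a neutral
   element; for N > 0 it is the (finite) minimum of the coordinates. *)
Definition min_coord (R : realType) (N : nat) (p : 'rV[R]_N) : \bar R :=
  \big[Order.min/+oo%E]_(i < N) (p ord0 i)%:E.

(* F p --> +oo as min_coord p --> -oo *)
Definition semi_coercive (R : realType) (N : nat) (F : 'rV[R]_N -> R) : Prop :=
  forall A : R, exists B : R,
    forall p : 'rV[R]_N, (min_coord p < B%:E)%E -> A < F p.

Definition nonincreasing_args (R : realType) (N : nat) (F : 'rV[R]_N -> R) :
    Prop :=
  forall (i : 'I_N) (p q : 'rV[R]_N),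
    (forall j, j != i -> p ord0 j = q ord0 j) ->
    p ord0 i <= q ord0 i -> F q <= F p.

(* For a <= b and H continuous these are the attained maximum and minimum over
   [a, b]: see max_onP and min_onP. *)
Definition max_on (R : realType) (H : R -> R) (a b : R) : R :=
  sup [set H s | s in `[a, b]%classic].

Definition min_on (R : realType) (H : R -> R) (a b : R) : R :=
  inf [set H s | s in `[a, b]%classic].

Lemma max_onP (R : realType) (H : R -> R) (a b : R) :
  a <= b -> continuous H ->
  (exists2 c, c \in `[a, b] & H c = max_on H a b) /\
  (forall s, s \in `[a, b] -> H s <= max_on H a b).
Proof.
move=> ab cH.
have [c cab Hc] := EVT_max ab (continuous_subspaceT cH).
suff E : max_on H a b = H c by rewrite E; split; first by exists c.
apply/eqP; rewrite eq_le; apply/andP; split.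
- by apply: ge_sup; [exists (H c); exists c | move=> _ [s sab <-]; exact: Hc].
- apply: ub_le_sup; last by exists c.
  by exists (H c) => _ [s sab <-]; exact: Hc.
Qed.

Lemma min_onP (R : realType) (H : R -> R) (a b : R) :
  a <= b -> continuous H ->
  (exists2 c, c \in `[a, b] & H c = min_on H a b) /\
  (forall s, s \in `[a, b] -> min_on H a b <= H s).
Proof.
move=> ab cH.
have [c cab Hc] := EVT_min ab (continuous_subspaceT cH).
suff E : min_on H a b = H c by rewrite E; split; first by exists c.
apply/eqP; rewrite eq_le; apply/andP; split.
- apply: ge_inf; last by exists c.
  by exists (H c) => _ [s sab <-]; exact: Hc.
- by apply: lb_le_inf; [exists (H c); exists c | move=> _ [s sab <-]; exact: Hc].
Qed.

Definition godunov (R : realType) (H : R -> R) (a b : R) : R :=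
  if a <= b then min_on H a b else max_on H b a.

Definition godunov_lower (R : realType) (H : R -> R) (q p : R) : set (\bar R) :=
  if q < p then [set -oo%E]
  else if q == p then `[-oo%E, (H p)%:E]%classic
  else [set (max_on H p q)%:E].

Definition godunov_upper (R : realType) (H : R -> R) (q p : R) : set (\bar R) :=
  if q < p then [set (min_on H q p)%:E]
  else if q == p then `[(H p)%:E, +oo%E]%classic
  else [set +oo%E].

(* "The value F q for any q such that ...": [get] picks an element of the set of
   all such values, which is a singleton whenever F is continuous, semi-coercive
   and nonincreasing in each argument and the H i are continuous and coercive. *)
Definition comp_flux (R : realType) (N : nat) (F : 'rV[R]_N -> R)
    (H : 'I_N -> R -> R) (p : 'rV[R]_N) : R :=
  get [set F q | q in
    [set q : 'rV[R]_N | forall i, F q = godunov (H i) (q ord0 i) (p ord0 i)]].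

Definition comp_lower (R : realType) (N : nat) (F : 'rV[R]_N -> R)
    (H : 'I_N -> R -> R) (p : 'rV[R]_N) : R :=
  get [set F q | q in
    [set q : 'rV[R]_N | forall i,
      godunov_lower (H i) (q ord0 i) (p ord0 i) (F q)%:E]].

Definition comp_upper (R : realType) (N : nat) (F : 'rV[R]_N -> R)
    (H : 'I_N -> R -> R) (p : 'rV[R]_N) : R :=
  get [set F q | q in
    [set q : 'rV[R]_N | forall i,
      godunov_upper (H i) (q ord0 i) (p ord0 i) (F q)%:E]].

(* Main.v *)
(* For fixed p, the graph {(q, l) | l \in G q p} of the Godunov flux, or of a
   semi-flux, is monotone, and is parametrized by x |-> (a x, b x) with a and b
   continuous and nondecreasing. Solving F q \in G^i (q_i) (p_i) for all i then
   amounts to F (a_i x_i)_i = b_j x_j for all j: maximize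
   min (F (a_i x_i)_i, min_j b_j x_j), push the maximizer up to the largest
   points at which the b_j have the optimal value, and apply the intermediate
   value theorem on the segment in between.
   The value F q is unique, and nonincreasing in p, because G is nondecreasing
   in q and nonincreasing in p.
   Finally, the value l = G(q, p) splits through an intermediate slope r: take
   r = p or r = q according to the sign of p - q, so that l lies both in the
   upper semi-flux at (q, r) and in the lower one at (r, p), or the other way
   round. Hence a solution for G at p is one for the iterated composition. *)
Require Import Defs.
From mathcomp Require Import all_boot all_order all_algebra.
From mathcomp Require Import all_classical all_reals all_analysis.
From mathcomp Require Import lra.
Set Implicit Arguments.
Unset Strict Implicit.
Unset Printing Implicit Defensive.

Import Order.TTheory GRing.Theory Num.Theory.
Import numFieldNormedType.Exports.
Local Open Scope classical_set_scope.
Local Open Scope ring_scope.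

(** * Vector preliminaries and the crossing lemma *)

Lemma row_continuous (R : realType) (T : topologicalType) (N : nat)
    (f : 'I_N -> T -> R) :
  (forall i, continuous (f i)) -> continuous (fun x => \row_i f i x).
Proof.
move=> fc x A /nbhs_ballP[e /= e0 eA].
suff: \forall y \near x, forall i, ball (f i x) e (f i y).
  apply: filterS => y H; apply: eA; split => // i j; rewrite !mxE; exact: H.
apply: filter_forall => i.
exact: (fc i x _ (nbhsx_ballx _ _ e0)).
Qed.

(** The point is the supremum of the closed sublevel set [f <= v]. The intermediate value theorem
    yields a point of value [v], necessarily below this supremum, so by monotonicity [f] is not
    smaller than [v] there. *)
Lemma max_preimage (R : realType) (f : R -> R) (v t : R) :
    continuous f -> f t <= v -> (exists k, v < f k) ->
    {homo f : x y / x <= y} ->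
  exists2 y, f y = v & forall z, y < z -> v < f z.
Proof.
move=> fc ftv [k vfk] fm.
set A := f @^-1` [set x | x <= v].
have Ak x : A x -> x <= k.
  by rewrite leNgt => /= fxv; apply/negP => /ltW/fm/(lt_le_trans vfk);
    rewrite ltNge fxv.
have A0 : A !=set0 by exists t.
have hA : has_sup A by split => //; exists k => x /Ak.
have cA : closed A.
  by apply: closed_comp => [x _|]; [exact: fc | exact: closed_le].
have Asup : A (sup A) by apply: cA; apply: closure_sup => //; case: hA.
have lub z : A z -> z <= sup A by move=> Az; apply: ub_le_sup => //; case: hA.
exists (sup A) => [|z Az]; last first.
  by rewrite ltNge; apply: contraL Az => /lub; rewrite leNgt.
have tk : t <= k by exact: Ak.
have [|c _ fcv] := @IVT R f t k v tk (continuous_subspaceT fc).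
  by rewrite ge_min le_max ftv (ltW vfk) orbT.
apply: le_anti; rewrite [_ <= v]Asup -{1}fcv fm//.
by apply: lub; rewrite /A /= fcv.
Qed.

(** Pass from [p] to [q] one coordinate at a time: [mix n] takes its first [n] coordinates from
    [q]. *)
Lemma nonincreasing_args_le (R : realType) (N : nat) (F : 'rV[R]_N -> R) :
  nonincreasing_args F ->
  forall p q : 'rV[R]_N, (forall i, p ord0 i <= q ord0 i) -> F q <= F p.
Proof.
move=> mF p q pq.
pose mix n : 'rV[R]_N := \row_i (if (i < n)%N then q ord0 i else p ord0 i).
have mixS n : (n <= N)%N -> F (mix n) <= F p.
  elim: n => [_|n IHn nN].
    suff -> : mix 0 = p by [].
    by apply/rowP => i; rewrite mxE.
  apply: le_trans (IHn (ltnW nN)); apply: (mF (Ordinal nN)) => [j jn|].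
    rewrite !mxE ltnS [(j <= n)%N]leq_eqVlt; case: eqP => //= E.
    by case/eqP: jn; apply: val_inj.
  by rewrite !mxE /= ltnn leqnn.
suff <- : mix N = q by exact: mixS.
by apply/rowP => i; rewrite mxE ltn_ord.
Qed.

(* The last hypothesis replaces b_i --> -oo, which fails for the Godunov flux;
   it keeps maximizing sequences from escaping to -oo. *)
Lemma crossing (R : realType) (N : nat) (Phi : 'rV[R]_N -> R)
    (b : 'I_N -> R -> R) :
  continuous Phi ->
  (forall x y : 'rV[R]_N, (forall i, x ord0 i <= y ord0 i) -> Phi y <= Phi x) ->
  (forall i, continuous (b i)) ->
  (forall i, {homo b i : x y / x <= y}) ->
  (forall i A, exists x, A < b i x) ->
  (forall i (z : 'rV[R]_N), exists2 t, t <= z ord0 i &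
     b i t <= Phi (\row_j if j == i then t else z ord0 j)) ->
  exists x : 'rV[R]_N, forall i, Phi x = b i (x ord0 i).
Proof.
move=> cPhi mPhi cb mb bub blow.
(* This makes [L] a strict upper bound of the function [psi] introduced below: [L <= psi x] would
   force all coordinates of [x] to be nonnegative, whence [Phi x <= Phi 0 < L]. *)
pose L := 1 + \big[Order.max/Phi 0]_i b i 0.
have PhiL : Phi 0 < L by rewrite ltr_pwDl// bigmax_ge_id.
have bL i : b i 0 < L by rewrite ltr_pwDl// le_bigmax_cond.
have /choice[k0 kL] : forall i, exists x, L < b i x by move=> i; exact: bub.
pose k : 'rV[R]_N := \row_i k0 i.
have {}kL i : L < b i (k ord0 i) by rewrite mxE.
have /choice[t tP] : forall i, exists t, t <= k ord0 i /\
    b i t <= Phi (\row_j if j == i then t else k ord0 j).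
  by move=> i; have [t ? ?] := blow i k; exists t.
(* The bound [L], never reached, only provides a constant neutral element. *)
pose psi x := Order.min (Phi x) (\big[Order.min/L]_i b i (x ord0 i)).
have psi_ge l x : l <= L -> l <= Phi x -> (forall i, l <= b i (x ord0 i)) ->
    l <= psi x.
  by move=> lL lP lb; rewrite le_min lP; apply/bigmin_geP; split.
have psi_Phi x : psi x <= Phi x by rewrite ge_min lexx.
have psi_b x i : psi x <= b i (x ord0 i) by rewrite ge_min bigmin_le_cond ?orbT.
have psi_L x : psi x < L.
  rewrite ltNge; apply/negP => Lpsi.
  have x0 i : 0 <= x ord0 i.
    rewrite leNgt; apply/negP => /ltW/(mb i); rewrite leNgt => /negP; apply.
    exact: lt_le_trans (bL i) (le_trans Lpsi (psi_b x i)).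
  have : Phi x <= Phi 0 by apply: mPhi => i; rewrite mxE.
  by rewrite leNgt (lt_le_trans PhiL)// (le_trans Lpsi).
have cpsi : continuous psi.
  apply: min_fun_continuous => //.
  apply: (@continuous_big _ _ Order.min) => [|i _]; first exact: min_continuous.
  move=> x; apply: continuous_comp; last exact: cb.
  exact: coord_continuous.
pose box := [set x : 'rV[R]_N | forall i, `[t i, k ord0 i]%classic (x ord0 i)].
have box0 : box !=set0.
  by exists k => i /=; rewrite in_itv /= lexx (tP i).1.
have cbox : compact box.
  apply: (@rV_compact _ _ (fun i => `[t i, k ord0 i]%classic)) => i.
  exact: segment_compact.
have [xm _ xmax] := EVT_max_rV box0 cbox (continuous_subspaceT cpsi).
pose l := psi xm.
(* The maximum over the box is global. Capping [x] at [k] does not lower [psi], which stays below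
   [L]; if a capped coordinate lies under [t i], then [k] with its [i]-th coordinate lowered to
   [t i] does at least as well. *)
have psi_l x : psi x <= l.
  pose x' : 'rV[R]_N := \row_i Order.min (x ord0 i) (k ord0 i).
  have xx' : psi x <= psi x'.
    apply: psi_ge => [||i]; first exact: ltW.
      rewrite (le_trans (psi_Phi x))//; apply: mPhi => i.
      by rewrite mxE ge_min lexx.
    rewrite mxE minEle; case: ifP => _; first exact: psi_b.
    exact: ltW (lt_trans (psi_L x) (kL i)).
  apply: (le_trans xx').
  have [/forallP tx'|/forallPn[i]] := boolP [forall i, t i <= x' ord0 i].
    apply: xmax; rewrite inE => i /=; rewrite in_itv /= tx' mxE ge_min lexx.
    by rewrite orbT.
  rewrite -ltNge => /ltW x't.
  pose z : 'rV[R]_N := \row_j if j == i then t i else k ord0 j.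
  apply: (@le_trans _ _ (psi z)).
    have x'bt : psi x' <= b i (t i).
      by apply: (le_trans (psi_b x' i)); apply: mb.
    apply: psi_ge => [||j]; first exact: ltW.
      exact: le_trans x'bt (tP i).2.
    rewrite mxE; case: eqP => [-> //|_].
    exact: ltW (lt_trans (psi_L x') (kL j)).
  apply: xmax; rewrite inE => j /=; rewrite in_itv /= mxE.
  by case: eqP => [->|_]; rewrite lexx (tP _).1.
(* This gives [max_preimage] a point where [b i] is at most [l]. *)
have btl i : b i (t i) <= l.
  have [btL|Lbt] := leP (b i (t i)) L; last first.
    pose z : 'rV[R]_N := \row_j if j == i then t i else k ord0 j.
    suff : L <= psi z by rewrite leNgt psi_L.
    apply: psi_ge => // [|j]; first exact: le_trans (ltW Lbt) (tP i).2.
    by rewrite mxE; case: eqP => [->|_]; exact: ltW.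
  apply: le_trans (psi_l (\row_j if j == i then t i else k ord0 j)).
  apply: psi_ge => // [|j]; first exact: (tP i).2.
  rewrite mxE; case: eqP => [-> //|_]; exact: le_trans btL (ltW _).
have /choice[y0 y0P] : forall i, exists y,
    b i y = l /\ forall z, y < z -> l < b i z.
  move=> i; have [y ? ?] := max_preimage (cb i) (btl i) (bub i l) (mb i).
  by exists y.
(* At [xm] each [b i] is only known to be at least [l]; capping at [y0] makes it equal to [l] and
   can only increase [Phi]. *)
pose w : 'rV[R]_N := \row_i Order.min (xm ord0 i) (y0 i).
have bw i : b i (w ord0 i) = l.
  rewrite mxE; have [xy|_] := leP (xm ord0 i) (y0 i); last exact: (y0P i).1.
  by apply: le_anti; rewrite psi_b -(y0P i).1 mb.
have Phiw : l <= Phi w.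
  by apply: (le_trans (psi_Phi xm)); apply: mPhi => i; rewrite mxE ge_min lexx.
(* On the segment from [w] to [y0] monotonicity freezes every [b i] at [l], while [Phi] starts at or
   above [l] and ends at or below it. *)
pose path s : 'rV[R]_N := \row_i (w ord0 i + s * (y0 i - w ord0 i)).
have cpath : continuous (Phi \o path).
  move=> s; apply: continuous_comp; last exact: cPhi.
  apply: row_continuous => i {}s; apply: cvgD; first exact: cvg_cst.
  by apply: cvgMl; exact: cvg_id.
(* Otherwise moving up from [y0] would increase [psi] above its maximum. *)
have Phiy : Phi (\row_i y0 i) <= l.
  rewrite leNgt; apply/negP => lPhi.
  pose up s : 'rV[R]_N := \row_i (y0 i + s).
  have cup : continuous (Phi \o up).
    move=> s; apply: continuous_comp; last exact: cPhi.
    apply: row_continuous => i {}s.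
    by apply: cvgD; [exact: cvg_cst|exact: cvg_id].
  have : \forall s \near 0, l < Phi (up s).
    apply: (cvgr_gt _ (cup 0)) => /=.
    suff -> : up 0 = \row_i y0 i by [].
    by apply/rowP => i; rewrite !mxE addr0.
  case/nbhs_ballP => e /= e0 /(_ (e / 2)) H.
  have {}H : l < Phi (up (e / 2)).
    by apply: H; rewrite /ball /= sub0r normrN gtr0_norm ?divr_gt0//; lra.
  have : l < psi (up (e / 2)).
    rewrite lt_min H; apply/bigmin_gtP; split=> [|i _]; first exact: psi_L.
    by rewrite mxE; apply: (y0P i).2; rewrite ltrDl divr_gt0.
  by rewrite ltNge psi_l.
have path0 : path 0 = w by apply/rowP => i; rewrite mxE mul0r addr0.
have path1 : path 1 = \row_i y0 i by apply/rowP => i; rewrite !mxE; lra.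
have [|s s01 /= Es] := @IVT R (Phi \o path) 0 1 l ler01
    (continuous_subspaceT cpath).
  by rewrite /= path0 path1 ge_min le_max Phiy Phiw orbT.
exists (path s) => i; rewrite Es; apply: le_anti.
have wy : w ord0 i <= y0 i by rewrite mxE ge_min lexx orbT.
move: s01; rewrite in_itv /= => /andP[s0 s1].
have -> : path s ord0 i = w ord0 i + s * (y0 i - w ord0 i) by rewrite mxE.
by rewrite -{1}(bw i) -(y0P i).1 !mb//; nra.
Qed.

(** * Running maxima and minima of a continuous function *)

Section RunningExtrema.
Variables (R : realType) (H : R -> R).
Hypothesis cH : continuous H.

Lemma max_on_ge a b s : a <= s <= b -> H s <= max_on H a b.
Proof.
move=> /andP[sa sb]; apply: (max_onP (le_trans sa sb) cH).2.
by rewrite in_itv /= sa.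
Qed.

Lemma min_on_le a b s : a <= s <= b -> min_on H a b <= H s.
Proof.
move=> /andP[sa sb]; apply: (min_onP (le_trans sa sb) cH).2.
by rewrite in_itv /= sa.
Qed.

Lemma max_on_sub a b a' b' :
  a' <= a -> a <= b -> b <= b' -> max_on H a b <= max_on H a' b'.
Proof.
move=> a'a ab bb'; have [[c + <-] _] := max_onP ab cH.
rewrite in_itv /= => /andP[ac cb]; apply: max_on_ge.
by rewrite (le_trans a'a) ?(le_trans cb).
Qed.

Lemma min_on_sub a b a' b' :
  a' <= a -> a <= b -> b <= b' -> min_on H a' b' <= min_on H a b.
Proof.
move=> a'a ab bb'; have [[c + <-] _] := min_onP ab cH.
rewrite in_itv /= => /andP[ac cb]; apply: min_on_le.
by rewrite (le_trans a'a) ?(le_trans cb).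
Qed.

Lemma max_on_xx a : max_on H a a = H a.
Proof.
have [[c + <-] _] := max_onP (lexx a) cH.
by rewrite in_itv /= => /le_anti ->.
Qed.

Lemma min_on_xx a : min_on H a a = H a.
Proof.
have [[c + <-] _] := min_onP (lexx a) cH.
by rewrite in_itv /= => /le_anti ->.
Qed.

(** Clamping [x] at [p] extends the function to the whole line by the constant [H p], so that it can
    serve in a parametrization by a real variable. *)
Definition running_max p x : R := max_on H p (Order.max x p).

Definition running_min p x : R := min_on H (Order.min x p) p.

Lemma running_max_homo p : {homo running_max p : x y / x <= y}.
Proof.
move=> x y xy; apply: max_on_sub => //; first by rewrite le_max lexx orbT.
by rewrite ge_max !le_max xy lexx orbT.
Qed.

Lemma running_min_homo p : {homo running_min p : x y / x <= y}.
Proof.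
move=> x y xy; apply: min_on_sub => //; last by rewrite ge_min lexx orbT.
by rewrite le_min !ge_min xy lexx orbT.
Qed.

Lemma running_max_ge p x : H (Order.max x p) <= running_max p x.
Proof. by rewrite max_on_ge// lexx le_max lexx orbT. Qed.

(** The maximum up to [y] is attained either in the range already covered by [x], or between [x] and
    [y], where the hypothesis bounds [H]. *)
Lemma running_max_le_add p x y e : 0 <= e ->
  (forall s, x <= s <= y -> H (Order.max s p) <= H (Order.max x p) + e) ->
  running_max p y <= running_max p x + e.
Proof.
move=> e0 He.
have py : p <= Order.max y p by rewrite le_max lexx orbT.
rewrite {1}/running_max; have [[c + <-] _] := max_onP py cH.
rewrite in_itv /= => /andP[pc cy].
have [cx|xc] := leP c (Order.max x p).
  by rewrite (@le_trans _ _ (running_max p x)) ?lerDl// max_on_ge// pc.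
move: xc; rewrite gt_max => /andP[xc pc'].
move: cy; rewrite le_max [c <= p]leNgt pc' orbF => cy.
apply: le_trans (_ : H (Order.max x p) + e <= _); last first.
  by rewrite lerD2r running_max_ge.
by rewrite -{1}(max_l pc); apply: He; rewrite ltW.
Qed.

Lemma running_max_continuous p : continuous (running_max p).
Proof.
move=> y; apply/cvgrPdist_le => e e0.
have cg : continuous (fun x => H (Order.max x p)).
  move=> x; apply: continuous_comp; last exact: cH.
  by apply: continuous_max; [exact: cvg_id|exact: cvg_cst].
have e20 : 0 < e / 2 by rewrite divr_gt0.
have /cvgrPdist_le/(_ _ e20)/nbhs_ballP[d /= d0 Hd] := cg y.
apply/nbhs_ballP; exists d => //= x; rewrite /ball /= => yx.
(* Every [s] between [x] and [y] qualifies, so two errors of [e / 2] bound the oscillation of [H]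
   there by [e]. *)
have {}Hd s : `|y - s| <= `|y - x| ->
    `|H (Order.max y p) - H (Order.max s p)| <= e / 2.
  by move=> ys; apply: Hd; rewrite /ball /=; exact: le_lt_trans yx.
have Hx := Hd _ (lexx _).
have [xy|/ltW xy] := leP x y.
  rewrite ger0_norm ?subr_ge0 ?running_max_homo// lerBlDl.
  apply: running_max_le_add => [|s /andP[xs sy]]; first exact: ltW.
  have : `|y - s| <= `|y - x| by rewrite !ger0_norm ?subr_ge0// lerB.
  by move/Hd; move: Hx; rewrite !ler_norml; lra.
rewrite ler0_norm ?subr_le0 ?running_max_homo// opprB lerBlDl.
apply: running_max_le_add => [|s /andP[xs sy]]; first exact: ltW.
have : `|y - s| <= `|y - x| by rewrite !ler0_norm ?subr_le0// !opprB lerB.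
by move/Hd; move: Hx; rewrite !ler_norml; lra.
Qed.

End RunningExtrema.

(** The point reflection of the graph of [H] exchanges minima and maxima; continuity of
    [running_min] then follows from that of [running_max]. *)
Lemma min_on_opp (R : realType) (H : R -> R) (a b : R) :
  min_on H a b = - max_on (fun s => - H (- s)) (- b) (- a).
Proof.
rewrite /min_on /max_on /inf; congr (- sup _); apply/seteqP; split => x /=.
  move=> [_ [s + <-] <-]; rewrite in_itv /= => /andP[sa sb].
  by exists (- s); rewrite ?opprK// in_itv /= !lerN2 sa sb.
move=> [s + <-]; rewrite in_itv /= => /andP[sa sb].
exists (H (- s)) => //; exists (- s) => //.
by rewrite in_itv /= lerNr lerNl sa sb.
Qed.

Lemma running_min_continuous (R : realType) (H : R -> R) (p : R) :
  continuous H -> continuous (running_min H p).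
Proof.
move=> cH.
have -> : running_min H p =
    fun x => - running_max (fun s => - H (- s)) (- p) (- x).
  by apply/funext => x; rewrite /running_min /running_max min_on_opp oppr_min.
have cH' : continuous (fun s => - H (- s)).
  move=> s; apply: cvgN; apply: continuous_comp; last exact: cH.
  exact: opp_continuous.
move=> x; apply: cvgN; apply: continuous_comp; first exact: opp_continuous.
exact: running_max_continuous.
Qed.

(** * Godunov flux and semi-fluxes: monotonicity, splitting, parametrization *)

Section SemiFluxes.
Variables (R : realType) (H : R -> R).
Hypothesis cH : continuous H.

Lemma godunov_lowerP q p l : godunov_lower H q p l%:E <->
  q = p /\ l <= H p \/ p < q /\ l = max_on H p q.
Proof.
rewrite /godunov_lower; case: ltgtP => [qp|pq|->] /=.
- by split=> // -[[E]|[]//]; rewrite E ltxx in qp.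
- split=> [[->]|[[E]|[_ ->]//]]; first by right.
  by rewrite E ltxx in pq.
- rewrite in_itv /= leNye lee_fin; split=> [|[[]|[]]//].
  by left.
Qed.

Lemma godunov_upperP q p l : godunov_upper H q p l%:E <->
  q = p /\ H p <= l \/ q < p /\ l = min_on H q p.
Proof.
rewrite /godunov_upper; case: ltgtP => [qp|pq|->] /=.
- split=> [[->]|[[E]|[_ ->]//]]; first by right.
  by rewrite E ltxx in qp.
- by split=> // -[[E]|[]//]; rewrite E ltxx in pq.
- rewrite in_itv /= leey andbT lee_fin; split=> [|[[]|[]]//].
  by left.
Qed.

Lemma godunov_mono q q' r r' : q' < q -> r <= r' ->
  godunov H q' r' <= godunov H q r.
Proof.
move=> qq rr; rewrite /godunov.
have [q'r'|r'q'] := leP q' r'; have [qr|rq] := leP q r.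
- by apply: min_on_sub => //; exact: ltW.
(* The point [Order.max q' r] lies in both [[q', r']] and [[r, q]], so [H] there separates the
   minimum from the maximum. *)
- apply: le_trans (_ : H (Order.max q' r) <= _).
    by rewrite min_on_le// le_max lexx ge_max q'r' rr.
  by rewrite max_on_ge// ge_max !le_max lexx orbT (ltW qq) ltW.
- by have := lt_le_trans (lt_trans r'q' qq) (le_trans qr rr); rewrite ltxx.
- by apply: max_on_sub => //; exact: ltW.
Qed.

Lemma godunov_lower_mono q q' r r' l l' : q' < q -> r <= r' ->
  godunov_lower H q r l%:E -> godunov_lower H q' r' l'%:E -> l' <= l.
Proof.
move=> qq rr /godunov_lowerP lE /godunov_lowerP l'E.
(* A real value excludes the branch of [-oo]; hence [r < q], and [l] is a genuine maximum. *)
have r'q' : r' <= q' by case: l'E => -[] => [->|/ltW].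
have rq : r < q by rewrite (le_lt_trans rr)// (le_lt_trans r'q').
case: lE => -[] => [qr|_ ->]; first by rewrite qr ltxx in rq.
apply: le_trans (_ : max_on H r' q' <= _).
  by case: l'E => -[] => [-> l'H|_ ->]//; rewrite max_on_xx.
by apply: max_on_sub => //; exact: ltW.
Qed.

Lemma godunov_upper_mono q q' r r' l l' : q' < q -> r <= r' ->
  godunov_upper H q r l%:E -> godunov_upper H q' r' l'%:E -> l' <= l.
Proof.
move=> qq rr /godunov_upperP lE /godunov_upperP l'E.
have qr : q <= r by case: lE => -[] => [->|/ltW].
have q'r' : q' < r' by rewrite (lt_le_trans qq)// (le_trans qr).
case: l'E => -[] => [E|_ ->]; first by rewrite E ltxx in q'r'.
apply: le_trans (_ : min_on H q r <= _).
  by apply: min_on_sub => //; exact: ltW.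
by case: lE => -[] => [-> Hl|_ ->]//; rewrite min_on_xx.
Qed.

(** One of the two factors is taken on the diagonal, where the semi-flux is a half-line that
    contains the extremum realized by the other factor. *)
Lemma godunov_upper_lower q p : exists r,
  godunov_upper H q r (godunov H q p)%:E /\
  godunov_lower H r p (godunov H q p)%:E.
Proof.
rewrite /godunov; have [qp|pq] := leP q p.
  exists p; rewrite godunov_upperP godunov_lowerP; split.
    move: qp; rewrite le_eqVlt => /predU1P[->|qp]; last by right.
    by left; rewrite min_on_xx.
  by left; rewrite min_on_le// qp lexx.
exists q; rewrite godunov_upperP godunov_lowerP; split; last by right.
by left; rewrite max_on_ge// lexx ltW.
Qed.

Lemma godunov_lower_upper q p : exists r,
  godunov_lower H q r (godunov H q p)%:E /\
  godunov_upper H r p (godunov H q p)%:E.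
Proof.
rewrite /godunov; have [qp|pq] := leP q p.
  exists q; rewrite godunov_upperP godunov_lowerP; split.
    by left; rewrite min_on_le// qp lexx.
  move: qp; rewrite le_eqVlt => /predU1P[->|qp]; last by right.
  by left; rewrite min_on_xx.
exists p; rewrite godunov_upperP godunov_lowerP; split; first by right.
by left; rewrite max_on_ge// lexx ltW.
Qed.

(** On either side of [p] one of the running extrema equals [H p]. The formula is free of case
    distinctions, so continuity and monotonicity in [x] are inherited. *)
Lemma godunov_runningE p x :
  godunov H x p = running_min H p x + running_max H p x - H p.
Proof.
rewrite /godunov /running_min /running_max; case: leP => _.
  by rewrite max_on_xx// addrK.
by rewrite min_on_xx// addrAC subrr add0r.
Qed.

(** For [x] below [p] the slope stays at [p] and the value descends the vertical half-line at unit
    speed; beyond [p] the curve follows the running maximum. *)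
Lemma running_lower p x : godunov_lower H (Order.max x p) p
  (running_max H p x + Order.min (x - p) 0)%:E.
Proof.
rewrite godunov_lowerP /running_max; have [xp|px] := leP x p.
  by left; rewrite max_on_xx// gerDl ge_min subr_le0 xp.
by right; rewrite min_r ?addr0// subr_ge0 ltW.
Qed.

Lemma running_upper p x : godunov_upper H (Order.min x p) p
  (running_min H p x + Order.max (x - p) 0)%:E.
Proof.
rewrite godunov_upperP /running_min; have [xp|px] := ltP x p.
  by right; rewrite max_r ?addr0// subr_le0 ltW.
by left; rewrite min_on_xx// lerDl le_max subr_ge0 px.
Qed.

Lemma running_max_unbounded p A :
  coercive H -> exists2 x, p <= x & A < running_max H p x.
Proof.
move=> /(_ A)[B HB]; exists (Order.max p (`|B| + 1)).
  by rewrite le_max lexx.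
apply: lt_le_trans (running_max_ge cH p _); apply: HB.
apply: lt_le_trans (ler_norm _); rewrite !lt_max.
by rewrite [B < `|B| + 1](le_lt_trans (ler_norm B)) ?ltrDl ?ltr01 ?orbT.
Qed.

End SemiFluxes.

(** * Existence, uniqueness and monotonicity of the value [F q] *)

Section Values.
Variables (R : realType) (N : nat) (F : 'rV[R]_N -> R).
Hypothesis mF : forall p q : 'rV[R]_N,
  (forall i, p ord0 i <= q ord0 i) -> F q <= F p.

(* [comp_flux], [comp_lower] and [comp_upper] are convertible to instances of
   this definition. *)
Definition flux_value (G : 'I_N -> R -> R -> set R) (p : 'rV[R]_N) : R :=
  get [set F q | q in
    [set q : 'rV[R]_N | forall i, G i (q ord0 i) (p ord0 i) (F q)]].

(** The inequality [q' < q] is strict because a semi-flux on the diagonal is multivalued and does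
    not order its values. *)
Definition flux_mono (G : 'I_N -> R -> R -> set R) : Prop :=
  forall i q q' r r' l l', q' < q -> r <= r' ->
    G i q r l -> G i q' r' l' -> l' <= l.

(** If [F q < F q'], monotonicity of [G] excludes [q'_i < q_i] for every [i]; then [q <= q']
    coordinatewise, and [F] nonincreasing gives a contradiction. *)
Lemma flux_solution_le G (r r' q q' : 'rV[R]_N) : flux_mono G ->
  (forall i, r ord0 i <= r' ord0 i) ->
  (forall i, G i (q ord0 i) (r ord0 i) (F q)) ->
  (forall i, G i (q' ord0 i) (r' ord0 i) (F q')) ->
  F q' <= F q.
Proof.
move=> mG rr Gq Gq'; rewrite leNgt; apply/negP => FF.
suff : F q' <= F q by rewrite leNgt FF.
apply: mF => i; rewrite leNgt; apply/negP => qq.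
by have := mG _ _ _ _ _ _ _ qq (rr i) (Gq i) (Gq' i); rewrite leNgt FF.
Qed.

Lemma flux_valueE G (p q : 'rV[R]_N) : flux_mono G ->
  (forall i, G i (q ord0 i) (p ord0 i) (F q)) -> flux_value G p = F q.
Proof.
move=> mG Gq; rewrite /flux_value; set S := (X in get X).
have [|q' Gq' <-] := @getPex _ S; first by exists (F q); exists q.
have pp i : p ord0 i <= p ord0 i by [].
apply: le_anti.
by rewrite (flux_solution_le mG pp Gq Gq') (flux_solution_le mG pp Gq' Gq).
Qed.

Lemma flux_solution_ex (G : 'I_N -> R -> R -> set R) (p : 'rV[R]_N)
    (a b : 'I_N -> R -> R) :
  continuous F -> semi_coercive F ->
  (forall i, continuous (a i)) -> (forall i, {homo a i : x y / x <= y}) ->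
  (forall i, continuous (b i)) -> (forall i, {homo b i : x y / x <= y}) ->
  (forall i A, exists x, A < b i x) ->
  (forall i A, exists x, a i x < A \/ b i x <= A) ->
  (forall i x, G i (a i x) (p ord0 i) (b i x)) ->
  exists q : 'rV[R]_N, forall i, G i (q ord0 i) (p ord0 i) (F q).
Proof.
move=> cF sF ca ma cb mb bub ablow Gab.
pose A (x : 'rV[R]_N) : 'rV[R]_N := \row_i a i (x ord0 i).
have [] := @crossing _ _ (F \o A) b => //=.
- move=> x; apply: continuous_comp; last exact: cF.
  apply: row_continuous => i {}x; apply: continuous_comp; last exact: ca.
  exact: coord_continuous.
- by move=> x y xy; apply: mF => i; rewrite !mxE; exact: ma.
- move=> i z; have [B HB] := sF (b i (z ord0 i)).
  (* One threshold serves both alternatives: [a i] below [B] makes [F] large by semi-coercivity, and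
     [b i] below [F (A z)] is enough since lowering a coordinate increases [F]. *)
  have [x xlow] := ablow i (Order.min B (F (A z))).
  pose t := Order.min x (z ord0 i).
  have tz : t <= z ord0 i by rewrite ge_min lexx orbT.
  have tx : t <= x by rewrite ge_min lexx.
  exists t => //; case: xlow => [ax|bx].
    apply: le_trans (mb i _ _ tz) (ltW (HB _ _)).
    apply: (@le_lt_trans _ _ (a i t)%:E).
      rewrite /min_coord (bigD1 i)//= !mxE eqxx.
      by rewrite ge_min lexx.
    rewrite lte_fin (le_lt_trans (ma i _ _ tx))//.
    by rewrite (lt_le_trans ax)// ge_min lexx.
  apply: le_trans (mb i _ _ tx) (le_trans bx _).
    rewrite ge_min; apply/orP; right.
  by apply: mF => j; rewrite !mxE ma//; case: eqP => [->|].
- by move=> x Ex; exists (A x) => i; rewrite (Ex i) mxE.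
Qed.

End Values.

(** * Iterated compositions *)

(** The slopes that split a solution [q] for [G] form a vector [r]. By uniqueness the inner value at
    [r] is [F q], so [r] solves the outer problem; outer uniqueness rests on the monotonicity of the
    inner value, [mF1]. *)
Lemma flux_value_comp (R : realType) (N : nat) (F : 'rV[R]_N -> R)
    (G1 G2 G : 'I_N -> R -> R -> set R) :
  (forall p q : 'rV[R]_N, (forall i, p ord0 i <= q ord0 i) -> F q <= F p) ->
  flux_mono G1 -> flux_mono G2 -> flux_mono G ->
  (forall p : 'rV[R]_N, exists q : 'rV[R]_N,
     forall i, G1 i (q ord0 i) (p ord0 i) (F q)) ->
  (forall p : 'rV[R]_N, exists q : 'rV[R]_N,
     forall i, G i (q ord0 i) (p ord0 i) (F q)) ->
  (forall i q p l, G i q p l -> exists r, G1 i q r l /\ G2 i r p l) ->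
  flux_value (flux_value F G1) G2 = flux_value F G.
Proof.
move=> mF mG1 mG2 mG ex1 ex split_G; apply/funext => p.
have mF1 (r r' : 'rV[R]_N) : (forall i, r ord0 i <= r' ord0 i) ->
    flux_value F G1 r' <= flux_value F G1 r.
  move=> rr; have [q Gq] := ex1 r; have [q' Gq'] := ex1 r'.
  rewrite (flux_valueE mF mG1 Gq) (flux_valueE mF mG1 Gq').
  exact: (flux_solution_le mF mG1 rr Gq Gq').
have [q Gq] := ex p; rewrite (flux_valueE mF mG Gq).
have /choice[r0 r0P] : forall i, exists s,
    G1 i (q ord0 i) s (F q) /\ G2 i s (p ord0 i) (F q).
  by move=> i; exact/split_G/Gq.
pose r : 'rV[R]_N := \row_i r0 i.
have Er : flux_value F G1 r = F q.
  by apply: flux_valueE => // i; rewrite mxE; exact: (r0P i).1.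
rewrite (flux_valueE mF1 mG2 (q := r)) => // i.
by rewrite Er mxE; exact: (r0P i).2.
Qed.

Theorem proposition3p5 (R : realType) (N : nat) (HN : (0 < N)%N)
    (H : 'I_N -> R -> R)
    (Hcont : forall i, continuous (H i))
    (Hcoer : forall i, coercive (H i))
    (F0 : 'rV[R]_N -> R)
    (F0cont : continuous F0)
    (F0mono : nonincreasing_args F0)
    (F0coer : semi_coercive F0) :
  comp_lower (comp_upper F0 H) H = comp_flux F0 H /\
  comp_flux F0 H = comp_upper (comp_lower F0 H) H.
Proof.
have mF := nonincreasing_args_le F0mono.
pose G i q p l := l = godunov (H i) q p.
pose Gl i q p l := godunov_lower (H i) q p l%:E.
pose Gu i q p l := godunov_upper (H i) q p l%:E.
have mG : flux_mono G.
  by move=> i q q' r r' l l' qq rr -> ->; exact: godunov_mono.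
have mGl : flux_mono Gl.
  by move=> i q q' r r' l l'; exact: godunov_lower_mono.
have mGu : flux_mono Gu.
  by move=> i q q' r r' l l'; exact: godunov_upper_mono.
have cmin (p : R) : continuous (fun x : R => Order.min (x - p) 0).
  move=> x; apply: (@continuous_min R R (fun x => x - p) (cst 0) x);
    last exact: cvg_cst.
  by apply: cvgB; [exact: cvg_id|exact: cvg_cst].
have cmax (p : R) : continuous (fun x : R => Order.max (x - p) 0).
  move=> x; apply: (@continuous_max R R (fun x => x - p) (cst 0) x);
    last exact: cvg_cst.
  by apply: cvgB; [exact: cvg_id|exact: cvg_cst].
have ex : forall p : 'rV[R]_N, exists q : 'rV[R]_N,
    forall i, G i (q ord0 i) (p ord0 i) (F0 q).
  move=> p; apply: (@flux_solution_ex _ _ _ mF G p (fun _ x => x)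
    (fun i x => running_min (H i) (p ord0 i) x + running_max (H i) (p ord0 i) x
                - H i (p ord0 i))) => //.
  - by move=> i x; exact: cvg_id.
  - by move=> i x y.
  - move=> i x /=; apply: cvgB; last exact: cvg_cst.
    apply: cvgD; first exact: running_min_continuous.
    exact: running_max_continuous.
  - by move=> i x y xy; rewrite lerD2r lerD ?running_min_homo ?running_max_homo.
  - move=> i A.
    have [x px Ax] := running_max_unbounded (Hcont i) (p ord0 i) A (Hcoer i).
    exists x; rewrite {1}/running_min min_r// min_on_xx//.
    by rewrite addrAC subrr add0r.
  - by move=> i A; exists (A - 1); left; rewrite ltrBlDr ltrDl.
  - by move=> i x; rewrite /G godunov_runningE.
have exl : forall p : 'rV[R]_N, exists q : 'rV[R]_N,
    forall i, Gl i (q ord0 i) (p ord0 i) (F0 q).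
  move=> p; apply: (@flux_solution_ex _ _ _ mF Gl p
    (fun i x => Order.max x (p ord0 i))
    (fun i x => running_max (H i) (p ord0 i) x
                + Order.min (x - p ord0 i) 0)) => //.
  - by move=> i x /=; apply: (@continuous_max R R);
      [exact: cvg_id|exact: cvg_cst].
  - by move=> i x y xy; rewrite ge_max !le_max xy lexx orbT.
  - move=> i x /=; apply: cvgD; first exact: running_max_continuous.
    exact: cmin.
  - move=> i x y xy; rewrite lerD ?running_max_homo//.
    by rewrite le_min !ge_min lerD2r xy lexx orbT.
  - move=> i A.
    have [x px Ax] := running_max_unbounded (Hcont i) (p ord0 i) A (Hcoer i).
    by exists x; rewrite min_r ?addr0// subr_ge0.
  (* Here [a i] never goes below [p], so [b i] must reach [A]: left of [p] it equals
     [H p + (x - p)]. *)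
  - move=> i A; exists (p ord0 i - `|A - H i (p ord0 i)|); right.
    rewrite /running_max max_r ?gerBl// max_on_xx// addrAC subrr add0r.
    by rewrite min_l ?oppr_le0// -lerBrDl lerNl -normrN ler_norm.
  - by move=> i x; exact: running_lower.
have exu : forall p : 'rV[R]_N, exists q : 'rV[R]_N,
    forall i, Gu i (q ord0 i) (p ord0 i) (F0 q).
  move=> p; apply: (@flux_solution_ex _ _ _ mF Gu p
    (fun i x => Order.min x (p ord0 i))
    (fun i x => running_min (H i) (p ord0 i) x
                + Order.max (x - p ord0 i) 0)) => //.
  - by move=> i x /=; apply: (@continuous_min R R);
      [exact: cvg_id|exact: cvg_cst].
  - by move=> i x y xy; rewrite le_min !ge_min xy lexx orbT.
  - move=> i x /=; apply: cvgD; first exact: running_min_continuous.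
    exact: cmax.
  - move=> i x y xy; rewrite lerD ?running_min_homo//.
    by rewrite ge_max !le_max lerD2r xy lexx orbT.
  (* The running minimum is at most [H p]; the growth comes from the vertical half-line, [b i] being
     [H p + (x - p)] right of [p]. *)
  - move=> i A; exists (p ord0 i + `|A - H i (p ord0 i)| + 1).
    have pos : 0 <= `|A - H i (p ord0 i)| by [].
    have AH := ler_norm (A - H i (p ord0 i)).
    rewrite /running_min min_r ?min_on_xx//; last by lra.
    by rewrite max_l; lra.
  - by move=> i A; exists (A - 1); left; rewrite gt_min ltrBlDr ltrDl ltr01.
  - by move=> i x; exact: running_upper.
split; last apply/esym.
  apply: (flux_value_comp mF mGu mGl mG exu ex) => i q p l ->.
  exact: godunov_upper_lower.
apply: (flux_value_comp mF mGl mGu mG exl ex) => i q p l ->.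
exact: godunov_lower_upper.
Qed.
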